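(* Let $X$ be a real Banach space such that $X^*$ and $X^{**}$ are strictly convex, $X$ has the w-Kadec-Klee property and $X^*$ has the $w^*$-Kadec-Klee property. Let $A:X\rightrightarrows X^*$ be a maximal monotone operator of type (D). Then for every $x\in D(A)$ and $v\in X\setminus\{0\}$, $$\sigma_{Ax}(v)=\liminf_{t\downarrow0,\ w\to v}\langle A^\circ(x+tw),w\rangle,$$ with the convention $\langle A^\circ(x+tw),w\rangle=+\infty$ if $x+tw\notin D(A)$.
   Context: $\sigma_{Ax}(v)=\sup_{x^*\in Ax}\langle x^*,v\rangle$. $A^\circ y$ is the unique element of minimal norm in $Ay$ (unique since $X^*$ is strictly convex). The liminf means $\lim_{\delta\downarrow0}\inf\{\langle A^\circ(x+tw),w\rangle: 0<t<\delta,\ \|w-v\|<\delta\}$. Type (D): for every $(x^{**},x^* )\in X^{**}\times X^*$ with $\langle x^*-y^*,x^{**}-y\rangle\ge0$ for all $(y,y^* )\in Gr(A)$ there is a bounded net $(x_i,x_i^* )$ in $Gr(A)$ with $x_i\to x^{**}$ in $\tau(X^{**},X^* )$ and $x_i^*\to x^*$ in norm. $X$ has the w-Kadec-Klee property if every net with $x_i\to x$ weakly and $\|x_i\|\to\|x\|$ converges in norm; $X^*$ has the $w^*$-Kadec-Klee property if every net with $x_i^*\to x^*$ weak$^*$ and $\|x_i^*\|\to\|x^*\|$ converges in norm. *)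

(* Defs.v *)
From HB Require Import structures.
From mathcomp Require Import all_boot all_order all_algebra.
From mathcomp Require Import all_classical all_reals all_analysis.
From Stdlib Require Import ClassicalEpsilon.
Set Implicit Arguments. Unset Strict Implicit. Unset Printing Implicit Defensive.
Import Order.TTheory GRing.Theory Num.Theory.
Import numFieldNormedType.Exports.
Local Open Scope classical_set_scope.
Local Open Scope ring_scope.

Section Banach.
Variables (R : realType) (X : normedModType R).

Definition dual_elem (f : X -> R) : Prop :=
  (forall (a : R) (x y : X), f (a *: x + y) = a * f x + f y) /\
  (exists C : R, forall x : X, `|f x| <= C * `|x|).

Definition dnorm (f : X -> R) : R :=
  sup [set `|f x| | x in [set x : X | `|x| <= 1]].

Definition bidual_elem (F : (X -> R) -> R) : Prop :=
  (forall (a : R) (f g : X -> R), dual_elem f -> dual_elem g ->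
     F (fun x => a * f x + g x) = a * F f + F g) /\
  (exists C : R, forall f, dual_elem f -> `|F f| <= C * dnorm f).

Definition bdnorm (F : (X -> R) -> R) : R :=
  sup [set `|F f| | f in [set f | dual_elem f /\ dnorm f <= 1]].

Definition dual_strictly_convex : Prop :=
  forall f g : X -> R, dual_elem f -> dual_elem g ->
    dnorm f = 1 -> dnorm g = 1 -> f <> g ->
    dnorm (fun x => (f x + g x) / 2) < 1.

Definition bidual_strictly_convex : Prop :=
  forall F G : (X -> R) -> R, bidual_elem F -> bidual_elem G ->
    bdnorm F = 1 -> bdnorm G = 1 ->
    (exists f, dual_elem f /\ F f <> G f) ->
    bdnorm (fun f => (F f + G f) / 2) < 1.

Definition directed (I : Type) (le : I -> I -> Prop) : Prop :=
  inhabited I /\ (forall i, le i i) /\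
  (forall i j k, le i j -> le j k -> le i k) /\
  (forall i j, exists k, le i k /\ le j k).

Definition net_lim (I : Type) (le : I -> I -> Prop) (u : I -> R) (l : R) : Prop :=
  forall e : R, 0 < e -> exists i0, forall i, le i0 i -> `|u i - l| < e.

Definition w_Kadec_Klee : Prop :=
  forall (I : Type) (le : I -> I -> Prop), directed le ->
  forall (u : I -> X) (x : X),
    (forall f, dual_elem f -> net_lim le (fun i => f (u i)) (f x)) ->
    net_lim le (fun i => `|u i|) `|x| ->
    net_lim le (fun i => `|u i - x|) 0.

Definition wstar_Kadec_Klee : Prop :=
  forall (I : Type) (le : I -> I -> Prop), directed le ->
  forall (u : I -> X -> R) (f : X -> R),
    (forall i, dual_elem (u i)) -> dual_elem f ->
    (forall x : X, net_lim le (fun i => u i x) (f x)) ->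
    net_lim le (fun i => dnorm (u i)) (dnorm f) ->
    net_lim le (fun i => dnorm (fun x => u i x - f x)) 0.

Definition monotone_op (A : X -> set (X -> R)) : Prop :=
  (forall x f, A x f -> dual_elem f) /\
  (forall x y f g, A x f -> A y g -> 0 <= f (x - y) - g (x - y)).

Definition maximal_monotone (A : X -> set (X -> R)) : Prop :=
  monotone_op A /\
  (forall x f, dual_elem f ->
     (forall y g, A y g -> 0 <= f (x - y) - g (x - y)) -> A x f).

(** type (D) (Gossez); the convergence x_i -> x** is in the weak-star
    topology of the bidual (sigma(bidual, dual)) *)
Definition type_D (A : X -> set (X -> R)) : Prop :=
  forall (F : (X -> R) -> R) (f : X -> R), bidual_elem F -> dual_elem f ->
    (forall y g, A y g -> 0 <= F (fun z => f z - g z) - (f y - g y)) ->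
    exists (I : Type) (le : I -> I -> Prop) (u : I -> X) (uf : I -> X -> R),
      [/\ directed le,
          (forall i, A (u i) (uf i)),
          (exists M : R, forall i, `|u i| <= M /\ dnorm (uf i) <= M),
          (forall h, dual_elem h -> net_lim le (fun i => h (u i)) (F h)) &
          net_lim le (fun i => dnorm (fun z => uf i z - f z)) 0].

Definition dom_op (A : X -> set (X -> R)) : set X := [set x | exists f, A x f].

Definition is_min_norm (A : X -> set (X -> R)) (y : X) (a : X -> R) : Prop :=
  A y a /\ forall b, A y b -> dnorm a <= dnorm b.

(** A° y : the element of minimal norm of A y (chosen by epsilon; unique
    and existing under the theorem's hypotheses when y \in D(A)) *)
Definition Amin (A : X -> set (X -> R)) (y : X) : X -> R :=
  epsilon (inhabits (fun _ : X => 0)) (is_min_norm A y).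

Definition support_fun (A : X -> set (X -> R)) (x v : X) : \bar R :=
  ereal_sup [set (f v)%:E | f in A x].

Definition dir_val (A : X -> set (X -> R)) (x : X) (t : R) (w : X) : \bar R :=
  if pselect (dom_op A (x + t *: w)) then (Amin A (x + t *: w) w)%:E
  else +oo%E.

(** liminf_{t -> 0+, w -> v} <A°(x+tw), w>
    = lim_{delta -> 0+} inf { ... : 0 < t < delta, |w - v| < delta }
    = sup_{delta > 0} inf { ... }   (the inf is nonincreasing in delta) *)
Definition liminf_dir (A : X -> set (X -> R)) (x v : X) : \bar R :=
  ereal_sup [set ereal_inf [set y | exists (t : R) (w : X),
                 [/\ 0 < t, t < d, `|w - v| < d & y = dir_val A x t w]]
            | d in [set d : R | 0 < d]].

End Banach.

(* Main.v *)
(** Monotonicity gives "<=": if [f] is in [A x] and [x + t w] in [D(A)], then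
    [<A°(x + t w), w> >= <f, w>].  For ">=", fix [eps > 0] and solve
    approximately, for [t -> 0+], the regularized inclusion
      [0 \in J(w - v) / eps + A (x + t w)]
    ([J] the duality mapping): there is [a] in [A (x + t w)] with
      [<a, w - v> + |w - v|^2 / (2 eps) + (eps / 2) |a|^2 <= small].
    Testing monotonicity against [a0] in [A x] with [<a0, v>] close to the
    supremum, and using that weak* cluster points of [a] as [t -> 0] lie in
    [A x], shows that [|w - v|], [|w - v| |a|] tend to [0] with [eps]; as
    [|A°(x + t w)| <= |a|] this bounds the liminf.

    In a nonreflexive space the inclusion is solved through the Fitzpatrick
    function: type (D) yields the negative infimum property, Hahn-Banach turns it
    into almost solutions on the epigraph of the Fitzpatrick function, and
    a Brondsted-Rockafellar iteration moves these onto the graph of [A]. *)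

Require Import Defs.
From HB Require Import structures.
From mathcomp Require Import all_boot all_order all_algebra.
From mathcomp Require Import all_classical all_reals all_analysis.
From mathcomp Require Import ring lra.
From Stdlib Require ClassicalEpsilon.
Set Implicit Arguments.
Unset Strict Implicit.
Unset Printing Implicit Defensive.
Import Order.TTheory GRing.Theory Num.Theory.
Import numFieldNormedType.Exports.
Local Open Scope classical_set_scope.
Local Open Scope ring_scope.

(** * The Hahn-Banach sandwich theorem *)

Section HahnBanach.
Context {R : realType} {V : lmodType R}.
Implicit Types (p q : V -> R) (x y z : V).

(** Homogeneity is required only as an inequality; applying it again with [a^-1] gives equality, so
    infima have less to verify. *)
Definition sublinear p :=
  (forall x y, p (x + y) <= p x + p y) /\
  (forall a x, 0 < a -> p (a *: x) <= a * p x).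

Definition linear_form (L : V -> R) :=
  forall a x y, L (a *: x + y) = a * L x + L y.

Lemma sublinearZ p a x : sublinear p -> 0 < a -> p (a *: x) = a * p x.
Proof.
move=> [_ pZ] a0; apply/eqP; rewrite eq_le pZ//=.
rewrite -ler_pdivlMl// (le_trans _ (pZ a^-1 (a *: x) _)) ?invr_gt0//.
by rewrite scalerA mulVf ?gt_eqF// scale1r.
Qed.

Lemma sublinear0 p : sublinear p -> p 0 = 0.
Proof.
move=> /(sublinearZ (a := 2) 0) -/(_ ltac:(lra)).
by rewrite scaler0; lra.
Qed.

Lemma sublinear_ge p x y : sublinear p -> p x - p (- y) <= p (x + y).
Proof. by move=> [pD _]; have := pD (x + y) (- y); rewrite addrK; lra. Qed.

(** An infimum of sublinear functions need not be subadditive; the condition on [q1] and [q2] lets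
    one member of [S] serve both summands. Chains, difference quotients along a ray and quotients
    built from an epigraph all satisfy it. *)
Lemma sublinear_inf (S : set (V -> R)) :
  S !=set0 ->
  (forall x, has_lbound [set q x | q in S]) ->
  (forall q1 q2 x y, S q1 -> S q2 ->
     exists2 q, S q & q (x + y) <= q1 x + q2 y) ->
  (forall q a x, S q -> 0 < a -> exists2 q', S q' & q' (a *: x) <= a * q x) ->
  sublinear (fun x => inf [set q x | q in S]).
Proof.
move=> [q0 Sq0] lb SD SZ.
have hi x : has_inf [set q x | q in S] by split => //; exists (q0 x), q0.
have infle q x : S q -> inf [set q x | q in S] <= q x.
  by move=> Sq; apply: ge_inf => //; exists q.
split=> [x y|a x a0].
- apply/ler_addgt0Pr => e e0.
  have [_ [q1 S1 <-] h1] := inf_adherent (eps := e / 2) ltac:(lra) (hi x).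
  have [_ [q2 S2 <-] h2] := inf_adherent (eps := e / 2) ltac:(lra) (hi y).
  have [q Sq hq] := SD _ _ x y S1 S2.
  by have := infle _ (x + y) Sq; lra.
- rewrite -ler_pdivrMl//; apply: lb_le_inf; first by exists (q0 x), q0.
  move=> _ [q Sq <-]; rewrite ler_pdivrMl//.
  have [q' Sq' h] := SZ q a x Sq a0.
  exact: le_trans (infle _ _ Sq') h.
Qed.

(* Zorn's lemma applied to the sublinear functions below [p]; a minimal one
   is linear, so no extension of partially defined functionals is needed. *)
Lemma sublinear_dominates_linear p : sublinear p ->
  exists L, linear_form L /\ forall x, L x <= p x.
Proof.
move=> sp.
pose T := {q : V -> R | sublinear q /\ forall x, q x <= p x}.
(* The order is reversed, so that Zorn's maximal element is a minimal sublinear function. *)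
pose le (q r : T) := `[< forall x, sval r x <= sval q x >].
have [||||[q [sq qp]] qmin] := @Zorn T le.
- by move=> t; apply/asboolP.
- move=> r s t /asboolP rs /asboolP st; apply/asboolP => x.
  exact: le_trans (st x) (rs x).
- move=> [s hs] [t ht] /asboolP /= st /asboolP /= ts; apply: eq_exist => /=.
  by apply/funext => x; apply/eqP; rewrite eq_le st ts.
- move=> C Ctot; have [[c Cc]|C0] := pselect (C !=set0); last first.
    exists (exist _ p (conj sp (fun x => lexx _))) => s Cs.
    by exfalso; apply: C0; exists s.
  pose S := [set sval r | r in C].
  have lb x : has_lbound [set q x | q in S].
    exists (- p (- x)) => _ [_ [[r [sr rp]] _ <-] <-] /=.
    have := sublinear_ge 0 x sr.
    by rewrite add0r (sublinear0 sr); have := rp (- x); lra.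
  have sS : sublinear (fun x => inf [set q x | q in S]).
    apply: sublinear_inf => //; first by exists (sval c), c.
    + move=> _ _ x y [r1 C1 <-] [r2 C2 <-].
      have := Ctot r1 r2 C1 C2; case=> /asboolP h.
        exists (sval r2); first by exists r2.
        by have := (proj1 (proj1 (svalP r2))) x y; have := h x; lra.
      exists (sval r1); first by exists r1.
      by have := (proj1 (proj1 (svalP r1))) x y; have := h y; lra.
    + move=> _ a x [r Cr <-] a0; exists (sval r); first by exists r.
      exact: (proj2 (proj1 (svalP r))).
  have infp x : inf [set q x | q in S] <= p x.
    apply: le_trans (proj2 (svalP c) x).
    by apply: ge_inf => //; exists (sval c) => //; exists c.
  exists (exist _ (fun x => inf [set q x | q in S]) (conj sS infp)).
  move=> s Cs; apply/asboolP => x /=.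
  by apply: ge_inf => //; exists (sval s) => //; exists s.
have {}qmin r : sublinear r -> (forall x, r x <= q x) -> r = q.
  move=> sr rq; have rp x : r x <= p x := le_trans (rq x) (qp x).
  have := qmin (exist _ r (conj sr rp)) ltac:(exact/asboolP).
  by move=> /(congr1 sval).
have q0 := sublinear0 sq.
have qD x y : q (x + y) = q x + q y.
  apply/eqP; rewrite eq_le (proj1 sq)/= -lerBrDr.
  (* The infimum of this family is sublinear and, by [t = 0], below [q]. Minimality makes it equal
     to [q], and [t = 1] then gives superadditivity. *)
  pose S := [set (fun u => q (u + t *: y) - t * q y) | t in [set t : R | 0 <= t]].
  have lb u : has_lbound [set r u | r in S].
    exists (- q (- u)) => _ [_ [t /= t0 <-] <-].
    rewrite (addrC u); have := sublinear_ge (t *: y) u sq.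
    suff -> : q (t *: y) = t * q y by lra.
    move: t0; rewrite le_eqVlt => /orP[/eqP<-|t0]; last exact: sublinearZ.
    by rewrite scale0r mul0r.
  have mem u t : 0 <= t -> inf [set r u | r in S] <= q (u + t *: y) - t * q y.
    move=> t0; apply: ge_inf => //.
    by exists (fun u => q (u + t *: y) - t * q y) => //; exists t.
  have /(congr1 (@^~ x)) /= <- : (fun u => inf [set r u | r in S]) = q.
    apply: qmin => [|u].
      apply: sublinear_inf => //.
      - by exists (fun u => q (u + 0 *: y) - 0 * q y), 0 => //=.
      - move=> _ _ u v [s /= s0 <-] [t /= t0 <-].
        exists (fun u => q (u + (s + t) *: y) - (s + t) * q y).
          by exists (s + t) => //=; exact: addr_ge0.
        rewrite scalerDl addrACA.
        by have := proj1 sq (u + s *: y) (v + t *: y); lra.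
      - move=> _ a u [t /= t0 <-] a0.
        exists (fun u => q (u + (a * t) *: y) - (a * t) * q y).
          by exists (a * t) => //=; rewrite mulr_ge0// ltW.
        rewrite -scalerA -scalerDr sublinearZ//.
        by rewrite mulrBr mulrA.
    by have := mem u 0 (lexx _); rewrite scale0r mul0r addr0 subr0.
  by have := mem x 1 ler01; rewrite scale1r mul1r.
have qN x : q (- x) = - q x by have := qD x (- x); rewrite subrr q0; lra.
exists q; split => // a x y; rewrite qD; congr (_ + _).
have [a0|a0|->] := ltgtP a 0; last by rewrite scale0r mul0r.
- rewrite -[a]opprK scaleNr qN sublinearZ ?oppr_gt0//; lra.
- exact: sublinearZ.
Qed.

(* [E] is the epigraph of a convex function that may take the value [+oo]. *)
Lemma sandwich (E : V -> R -> Prop) (q : V -> R) :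
  (exists e r, E e r) ->
  (forall s t e1 e2 r1 r2, 0 <= s -> 0 <= t -> s + t = 1 -> E e1 r1 -> E e2 r2 ->
     E (s *: e1 + t *: e2) (s * r1 + t * r2)) ->
  (forall s t x y, 0 <= s -> 0 <= t -> s + t = 1 ->
     q (s *: x + t *: y) <= s * q x + t * q y) ->
  (forall e r, E e r -> 0 <= r + q e) ->
  exists L, linear_form L /\ forall e r z, E e r -> L z <= r + q (e + z).
Proof.
move=> [e0 [r0 E0]] Ecv qcv pos.
(* As [L] is homogeneous, the required bound at [s *: z] reads [L z <= val s e r z]; the infimum of
   these quotients is the majorant to use, and [s = 1] returns the claim. *)
pose val (s : R) e r z := (r + q (e + s *: z)) / s.
pose S := [set f | exists s e r, [/\ 0 < s, E e r & f = val s e r]].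
have lb z : has_lbound [set f z | f in S].
  exists (- (r0 + q (e0 - z))) => _ [_ [s [e [r [s0 Er ->]]]] <-].
  rewrite /val ler_pdivlMr//.
  have s1 : 0 < 1 + s by lra.
  (* Since [b = a * s], the vector [z] cancels in the combination of [e + s *: z] and [e0 - z], and
     [pos] applies to what remains. *)
  pose a := (1 + s)^-1; pose b := s / (1 + s).
  have a0 : 0 < a by rewrite invr_gt0.
  have bE : b = a * s by rewrite /b mulrC.
  have b0 : 0 < b by rewrite bE mulr_gt0.
  have ab : a + b = 1 by rewrite /a /b; field; rewrite gt_eqF.
  have := pos _ _ (Ecv _ _ _ _ _ _ (ltW a0) (ltW b0) ab Er E0).
  have := qcv _ _ (e + s *: z) (e0 - z) (ltW a0) (ltW b0) ab.
  rewrite !scalerDr scalerN scalerA -bE addrACA subrr addr0 => h1 h2.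
  have : 0 <= a * (r + q (e + s *: z) + s * (r0 + q (e0 - z))).
    by rewrite bE in h1 h2; lra.
  by rewrite pmulr_rge0//; lra.
have sS : sublinear (fun z => inf [set f z | f in S]).
  apply: sublinear_inf => //.
  - by exists (val 1 e0 r0), 1, e0, r0.
  - move=> _ _ x y [s [e1 [r1 [s0 E1 ->]]]] [t [e2 [r2 [t0 E2 ->]]]].
    have st0 : 0 < s + t by lra.
    (* The weights equalize the step lengths, [a * s = b * t = c], so the combined direction is
       [c *: (x + y)]. *)
    pose a := t / (s + t); pose b := s / (s + t); pose c := s * t / (s + t).
    have a0 : 0 <= a by rewrite divr_ge0// ltW.
    have b0 : 0 <= b by rewrite divr_ge0// ltW.
    have ab : a + b = 1 by rewrite /a /b; field; rewrite gt_eqF.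
    have c0 : 0 < c by rewrite divr_gt0// mulr_gt0.
    have aE : a * s = c by rewrite /a /c; field; rewrite gt_eqF.
    have bE : b * t = c by rewrite /b /c; field; rewrite gt_eqF.
    exists (val c (a *: e1 + b *: e2) (a * r1 + b * r2)).
      by exists c, (a *: e1 + b *: e2), (a * r1 + b * r2); split => //; exact: Ecv.
    rewrite /val ler_pdivrMr// mulrDl.
    have -> : (r1 + q (e1 + s *: x)) / s * c = a * (r1 + q (e1 + s *: x)).
      by rewrite -aE; field; rewrite gt_eqF.
    have -> : (r2 + q (e2 + t *: y)) / t * c = b * (r2 + q (e2 + t *: y)).
      by rewrite -bE; field; rewrite gt_eqF.
    have := qcv a b (e1 + s *: x) (e2 + t *: y) a0 b0 ab.
    rewrite 2!scalerDr !scalerA aE bE addrACA -scalerDr; lra.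
  - move=> _ a x [s [e [r [s0 Er ->]]]] a0.
    exists (val (s / a) e r); first by exists (s / a), e, r; rewrite divr_gt0.
    by rewrite /val scalerA divfK ?gt_eqF// invf_div mulrCA lexx.
have [L [Llin Lle]] := sublinear_dominates_linear sS.
exists L; split => // e r z Er; apply: le_trans (Lle z) _.
apply: ge_inf => //; exists (val 1 e r); last by rewrite /val divr1 scale1r.
by exists 1, e, r.
Qed.

End HahnBanach.

(** * The dual space *)

Section Dual.
Context {R : realType} {X : normedModType R}.
Implicit Types (f g h : X -> R) (x y : X).

Lemma dual_elemD f x y : dual_elem f -> f (x + y) = f x + f y.
Proof. by move=> [fl _]; rewrite -[x in LHS]scale1r fl mul1r. Qed.

Lemma dual_elem0 f : dual_elem f -> f 0 = 0.
Proof. by move=> df; have := dual_elemD 0 0 df; rewrite addr0; lra. Qed.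

Lemma dual_elemZ f a x : dual_elem f -> f (a *: x) = a * f x.
Proof.
by move=> df; have := df.1 a x 0; rewrite !addr0 (dual_elem0 df) addr0.
Qed.

Lemma dual_elemN f x : dual_elem f -> f (- x) = - f x.
Proof. by move=> df; rewrite -scaleN1r dual_elemZ// mulN1r. Qed.

Lemma dual_elemB f x y : dual_elem f -> f (x - y) = f x - f y.
Proof. by move=> df; rewrite dual_elemD// dual_elemN. Qed.

Let unit_values f := [set `|f x| | x in [set x : X | `|x| <= 1]].

Let unit_values_has_sup f : dual_elem f -> has_sup (unit_values f).
Proof.
move=> [_ [C fC]]; split; first by exists `|f 0|, 0 => //=; rewrite normr0.
exists `|C| => _ [x /= x1 <-]; apply: le_trans (fC x) _.
by rewrite (le_trans (ler_norm _))// normrM normr_id ler_piMr.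
Qed.

Lemma dnorm_ge0 f : dual_elem f -> 0 <= dnorm f.
Proof.
move=> df; apply: le_trans (normr_ge0 (f 0)) _.
by apply: ub_le_sup; [exact: (unit_values_has_sup df).2|exists 0 => //=; rewrite normr0].
Qed.

Lemma le_dnorm f x : dual_elem f -> `|f x| <= dnorm f * `|x|.
Proof.
move=> df; have [->|x0] := eqVneq x 0.
  by rewrite dual_elem0// !normr0 mulr0.
have nx : 0 < `|x| by rewrite normr_gt0.
rewrite -ler_pdivrMr//; apply: ub_le_sup; first exact: (unit_values_has_sup df).2.
exists (`|x|^-1 *: x); first by rewrite /= normrZ normfV normr_id mulVf// gt_eqF.
by rewrite dual_elemZ// normrM normfV normr_id mulrC.
Qed.

Lemma dual_elem_le f x : dual_elem f -> f x <= dnorm f * `|x|.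
Proof. by move=> df; exact: le_trans (ler_norm _) (le_dnorm x df). Qed.

Lemma dual_elem_ge f x : dual_elem f -> - (dnorm f * `|x|) <= f x.
Proof. by move=> df; have := dual_elem_le (- x) df; rewrite dual_elemN// normrN; lra. Qed.

Lemma dnorm_le f (C : R) : 0 <= C -> (forall x, `|f x| <= C * `|x|) -> dnorm f <= C.
Proof.
move=> C0 fC; apply: ge_sup; first by exists `|f 0|, 0 => //=; rewrite normr0.
by move=> _ [x /= x1 <-]; rewrite (le_trans (fC x))// ler_piMr.
Qed.

Lemma dnorm_adherent f (e : R) : dual_elem f -> 0 < e ->
  exists x, `|x| <= 1 /\ dnorm f - e < f x.
Proof.
move=> df e0; have [_ [x /= x1 <-] fx] := sup_adherent e0 (unit_values_has_sup df).
have [f0|f0] := leP 0 (f x).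
  by exists x; split => //; move: fx; rewrite ger0_norm.
by exists (- x); rewrite normrN dual_elemN//; split => //; move: fx; rewrite ltr0_norm.
Qed.

Lemma dual_elem_lin (a : R) f g : dual_elem f -> dual_elem g ->
  dual_elem (fun x => a * f x + g x).
Proof.
move=> df dg; split; first by move=> b x y; rewrite df.1 dg.1; ring.
exists (`|a| * dnorm f + dnorm g) => x.
rewrite (le_trans (ler_normD _ _))// mulrDl lerD ?le_dnorm//.
by rewrite normrM -mulrA ler_wpM2l ?le_dnorm.
Qed.

Lemma dual_elem_cst0 : dual_elem (fun _ : X => 0 : R).
Proof. by split=> [a x y|]; [rewrite mulr0 addr0|exists 0 => x; rewrite normr0 mul0r]. Qed.

Lemma dual_elem_add f g : dual_elem f -> dual_elem g -> dual_elem (fun x => f x + g x).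
Proof.
move=> df dg; have := dual_elem_lin 1 df dg.
by under eq_fun do rewrite mul1r.
Qed.

Lemma dual_elem_opp f : dual_elem f -> dual_elem (fun x => - f x).
Proof.
move=> df; have := dual_elem_lin (-1) df dual_elem_cst0.
by under eq_fun do rewrite mulN1r addr0.
Qed.

Lemma dual_elem_sub f g : dual_elem f -> dual_elem g -> dual_elem (fun x => f x - g x).
Proof. by move=> df /dual_elem_opp; exact: dual_elem_add. Qed.

Lemma dnormD f g : dual_elem f -> dual_elem g ->
  dnorm (fun x => f x + g x) <= dnorm f + dnorm g.
Proof.
move=> df dg; apply: dnorm_le => [|x]; first by rewrite addr_ge0 ?dnorm_ge0.
by rewrite (le_trans (ler_normD _ _))// mulrDl lerD ?le_dnorm.
Qed.

Lemma dnorm_sub f g : dual_elem f -> dual_elem g ->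
  dnorm f <= dnorm g + dnorm (fun x => f x - g x).
Proof.
move=> df dg; have := dnormD dg (dual_elem_sub df dg).
by under eq_fun do rewrite addrC subrK.
Qed.

Lemma dnormZ (a : R) f : dual_elem f -> dnorm (fun x => a * f x) <= `|a| * dnorm f.
Proof.
move=> df; apply: dnorm_le => [|x]; first by rewrite mulr_ge0// dnorm_ge0.
by rewrite normrM -mulrA ler_wpM2l// le_dnorm.
Qed.

Definition dual_pred : {pred X -> R^o} := [pred f | `[< dual_elem f >]].

Lemma mem_dual_pred f : dual_elem f -> (f : X -> R^o) \in dual_pred.
Proof. by move=> ?; apply/asboolP. Qed.

Lemma dual_pred_submod_closed : submod_closed dual_pred.
Proof.
split; first exact/asboolP/dual_elem_cst0.
by move=> a f g /asboolP df /asboolP dg; exact/asboolP/dual_elem_lin.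
Qed.
HB.instance Definition _ := GRing.isSubmodClosed.Build R (X -> R^o) dual_pred
  dual_pred_submod_closed.

(** Bundling makes the product of [X] and its dual a module, to which the sandwich theorem
    applies. *)
Record dual_space := Dual { dual_val :> X -> R^o; _ : dual_val \in dual_pred }.
HB.instance Definition _ := [isSub for dual_val].
HB.instance Definition _ := [Choice of dual_space by <:].
HB.instance Definition _ := [SubChoice_isSubLmodule of dual_space by <:].

Lemma dual_valP (F : dual_space) : dual_elem F.
Proof. exact/asboolP/(valP F). Qed.

Lemma dual_valE (a b : R) (F G : dual_space) x :
  (a *: F + b *: G) x = a * F x + b * G x.
Proof. by []. Qed.

Lemma dual_space_eq (F G : dual_space) : (forall x, F x = G x) -> F = G.
Proof. by move=> FG; apply/val_inj/funext. Qed.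

(** The default [0] off the dual makes this total, since elements of the bidual are encoded as
    functions of an arbitrary [X -> R]. *)
Definition to_dual f : dual_space :=
  if pselect (dual_elem f) is left df then Dual (mem_dual_pred df) else 0.

Lemma to_dualE f : dual_elem f -> to_dual f = f :> (X -> R).
Proof. by move=> df; rewrite /to_dual; case: pselect. Qed.

End Dual.

(** * Fitzpatrick function and negative infimum property *)

Section NegativeInfimum.
Context {R : realType} {X : normedModType R}.
Implicit Types (f g h : X -> R) (x y p : X).

Lemma dnorm_subC f g :
  dnorm (fun x => f x - g x) = dnorm (fun x => g x - f x).
Proof.
rewrite /dnorm; congr (sup (image _ _)).
by apply/funext => x; rewrite distrC.
Qed.

Lemma linear_form0 (V : lmodType R) (u : V -> R) : linear_form u -> u 0 = 0.
Proof. by move=> ul; have := ul 1 0 0; rewrite scaler0 addr0; lra. Qed.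

Lemma linear_formZ (V : lmodType R) (u : V -> R) a z :
  linear_form u -> u (a *: z) = a * u z.
Proof. by move=> ul; rewrite -[a *: z]addr0 ul linear_form0// addr0. Qed.

(** Dividing [z] by [N z + d] with [d > 0] brings it into the unit ball even where [N z = 0]; the
    excess [C * d] is then made arbitrarily small. *)
Lemma linear_form_bounded (V : lmodType R) (N u : V -> R) (C : R) :
  linear_form u -> (forall z, 0 <= N z) -> (forall a z, N (a *: z) <= `|a| * N z) ->
  (forall z, N z <= 1 -> u z <= C) -> forall z, `|u z| <= C * N z.
Proof.
move=> ul N0 NZ uC.
have Nzero : N 0 <= 1 by have := NZ 0 0; rewrite scale0r normr0; lra.
have C0 : 0 <= C by rewrite -(linear_form0 ul); exact: uC.
have bnd z : u z <= C * N z.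
  apply/ler_addgt0Pr => e e0; pose d := e / (C + 1).
  have d0 : 0 < d by rewrite divr_gt0//; lra.
  have Cd : C * d <= e.
    by rewrite /d mulrCA ler_piMr ?(ltW e0)// ler_pdivrMr; lra.
  have s0 : 0 < N z + d by have := N0 z; lra.
  have : u ((N z + d)^-1 *: z) <= C.
    apply: uC; rewrite (le_trans (NZ _ _))// normfV gtr0_norm//.
    by rewrite mulrC ler_pdivrMr//; lra.
  rewrite linear_formZ// mulrC ler_pdivrMr// mulrDr; lra.
move=> z; rewrite ler_norml bnd andbT.
have := bnd (- 1 *: z); rewrite linear_formZ//.
have := ler_wpM2l C0 (NZ (-1) z); rewrite normrN1; lra.
Qed.

(** The convexity gap of the square is [a * b * (m - k) ^+ 2]. This makes the quadratic penalties
    convex. *)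
Lemma sqr_convex (a b m n k : R) : 0 <= a -> 0 <= b -> a + b = 1 ->
  0 <= n -> n <= a * m + b * k -> n ^+ 2 <= a * m ^+ 2 + b * k ^+ 2.
Proof.
move=> a0 b0 ab n0 nmk; have bE : b = 1 - a by lra.
apply: (@le_trans _ _ ((a * m + b * k) ^+ 2)).
  by rewrite ler_sqr ?nnegrE//; lra.
rewrite -subr_ge0.
have -> : a * m ^+ 2 + b * k ^+ 2 - (a * m + b * k) ^+ 2 = a * b * (m - k) ^+ 2.
  by rewrite bE; ring.
by rewrite mulr_ge0 ?sqr_ge0// mulr_ge0.
Qed.

(** The conjugate of [|x| ^+ 2 / (2 * l)] is [l / 2] times the squared dual norm; it is nearly
    attained at [l * dnorm f] times an almost norming vector of the unit ball. *)
Lemma norming_conjugate f (l e : R) : dual_elem f -> 0 < l -> 0 < e ->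
  exists x, l / 2 * dnorm f ^+ 2 - e <= f x - `|x| ^+ 2 / (2 * l).
Proof.
move=> df l0 e0; set n := dnorm f; have n0 : 0 <= n := dnorm_ge0 df.
pose d := e / (l * (n + 1)).
have d0 : 0 < d by rewrite divr_gt0// mulr_gt0//; lra.
have [x [x1 fx]] := dnorm_adherent df d0.
have lnd : l * n * d <= e.
  rewrite /d mulrA ler_pdivrMr ?mulr_gt0//; last by lra.
  by rewrite (mulrC _ e) ler_wpM2l ?(ltW e0)// ler_wpM2l ?(ltW l0)//; lra.
have ln0 : 0 <= l * n by rewrite mulr_ge0// ltW.
exists ((l * n) *: x); rewrite (dual_elemZ _ _ df) normrZ ger0_norm//.
have h1 : l * n * (n - d) <= l * n * f x by rewrite ler_wpM2l// ltW.
have h2 : (l * n * `|x|) ^+ 2 / (2 * l) <= l / 2 * n ^+ 2.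
  have -> : l / 2 * n ^+ 2 = (l * n) ^+ 2 / (2 * l) by field; rewrite gt_eqF.
  apply: ler_wpM2r; first by rewrite invr_ge0; lra.
  apply: lerXn2r; rewrite ?nnegrE ?mulr_ge0 ?(ltW l0)//.
  exact: ler_piMr.
rewrite -/n in fx; lra.
Qed.

(** Otherwise [(F, f)] is monotonically related to the graph, and type (D) supplies a bounded net
    whose functionals tend to [f] in norm. Along it the expression is at most [|C| + |M|] times the
    norm of [f - uf i], hence eventually below [d]. *)
Lemma type_D_neg_infimum (A : X -> set (X -> R)) F f (d : R) :
  type_D A -> (forall x g, A x g -> dual_elem g) ->
  bidual_elem F -> dual_elem f -> 0 < d ->
  exists y g, A y g /\ F (fun z => f z - g z) - (f y - g y) < d.
Proof.
move=> hD Adual dF df d0; apply: contrapT => noA.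
have far y g : A y g -> d <= F (fun z => f z - g z) - (f y - g y).
  by move=> Ayg; rewrite leNgt; apply/negP => lt; apply: noA; exists y, g.
have [I [le [u [uf [dir uA [M uM] _ ufl]]]]] :=
  hD F f dF df (fun y g Ayg => le_trans (ltW d0) (far y g Ayg)).
have [C FC] := dF.2.
pose e := d / (`|C| + `|M| + 1).
have CM0 : 0 < `|C| + `|M| + 1 by have := normr_ge0 C; have := normr_ge0 M; lra.
have e0 : 0 < e by rewrite divr_gt0.
have [i0 /(_ i0 (dir.2.1 i0))] := ufl e e0.
rewrite subr0 dnorm_subC; set h := (fun z => f z - uf i0 z) => he.
have dh : dual_elem h := dual_elem_sub df (Adual _ _ (uA i0)).
rewrite ger0_norm ?dnorm_ge0// in he.
have := far _ _ (uA i0); rewrite -/h => hfar.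
have h0 := dnorm_ge0 dh.
have h1 : F h <= `|C| * dnorm h.
  rewrite (le_trans (ler_norm _))// (le_trans (FC _ dh))//.
  by rewrite ler_wpM2r// ler_norm.
have h2 : - (f (u i0) - uf i0 (u i0)) <= `|M| * dnorm h.
  have := dual_elem_ge (u i0) dh; rewrite {2}/h.
  have : `|u i0| <= `|M| by rewrite (le_trans (uM i0).1)// ler_norm.
  by move=> /(ler_wpM2l h0); lra.
have : (`|C| + `|M| + 1) * dnorm h < d by rewrite mulrC -ltr_pdivlMr.
by lra.
Qed.

(* [r] is at least the value at [(x, f)] of the Fitzpatrick function of [A],
   which may be [+oo] *)
Definition fitz_le (A : X -> set (X -> R)) x f (r : R) : Prop :=
  forall y g, A y g -> g x + f y - g y <= r.

(** If the penalized Fitzpatrick function were at least [eta] everywhere, the sandwich theorem would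
    give a linear form on the product whose two components contradict the negative infimum
    property. *)
Lemma regularized_point (A : X -> set (X -> R)) p ps (l eta : R) :
  maximal_monotone A -> type_D A -> (exists x f, A x f) ->
  dual_elem ps -> 0 < l -> 0 < eta ->
  exists x f r, [/\ dual_elem f, fitz_le A x f r &
    r - f p - ps x + ps p + `|x - p| ^+ 2 / (2 * l) +
      l / 2 * dnorm (fun z => f z - ps z) ^+ 2 < eta].
Proof.
move=> hA hD [a0 [fa0 Aa0]] dps l0 eta0; apply: contrapT => noz.
have Adual x g : A x g -> dual_elem g := hA.1.1 x g.
pose V := (X * (@dual_space R X))%type.
pose q (z : V) : R := `|z.1| ^+ 2 / (2 * l) + l / 2 * dnorm z.2 ^+ 2.
(* This is the epigraph of the Fitzpatrick function recentred at [(p, ps)], with pairing terms and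
   [eta] subtracted, so that [r + q e < 0] yields a point of the required kind. *)
pose E (e : V) (r : R) := fitz_le A (e.1 + p) (fun x => e.2 x + ps x)
   (r + (e.2 p + ps p) + ps (e.1 + p) - ps p + eta).
have EA y g : A y g ->
    E (y - p, to_dual (fun x => g x - ps x)) ((g (y - p) - ps (y - p)) - eta).
  move=> Ayg; have dg := Adual _ _ Ayg.
  rewrite /E /= to_dualE; last exact: dual_elem_sub.
  move=> z h Azh; rewrite subrK !subrK.
  have := hA.1.2 _ _ _ _ Azh Ayg.
  rewrite !(dual_elemB _ _ dg) !(dual_elemB _ _ dps) !(dual_elemB _ _ (Adual _ _ Azh)).
  lra.
have [e0 [r0 E0]] : exists e r, E e r by do 2!eexists; exact: EA Aa0.
have [] := @sandwich R V E q.
- by exists e0, r0.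
- move=> s t e1 e2 r1 r2 s0 t0 st1 E1 E2 y g Ayg.
  have -> : (s *: e1 + t *: e2).2 = s *: e1.2 + t *: e2.2 by [].
  rewrite !dual_valE /=.
  have dg := Adual _ _ Ayg.
  have := ler_wpM2l s0 (E1 y g Ayg); have := ler_wpM2l t0 (E2 y g Ayg).
  rewrite !(dual_elemD _ _ dg) !(dual_elemZ _ _ dg).
  rewrite ?(dual_elemD _ _ dps) ?(dual_elemZ _ _ dps).
  have -> : t = 1 - s by lra.
  lra.
- move=> s t x y s0 t0 st1; rewrite /q /=.
  have h1 : `|s *: x.1 + t *: y.1| <= s * `|x.1| + t * `|y.1|.
    by rewrite (le_trans (ler_normD _ _))// !normrZ !ger0_norm.
  have h2 : dnorm (s *: x.2 + t *: y.2) <= s * dnorm x.2 + t * dnorm y.2.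
    have := dnormD (dual_valP (s *: x.2)) (dual_valP (t *: y.2)).
    have := dnormZ s (dual_valP x.2); have := dnormZ t (dual_valP y.2).
    rewrite !ger0_norm//; set u := dnorm (fun x => t * _); set v := dnorm (fun x => s * _).
    by move=> ? ? h; apply: (le_trans h); apply: lerD.
  have {}h1 := sqr_convex s0 t0 st1 (normr_ge0 _) h1.
  have {}h2 := sqr_convex s0 t0 st1 (dnorm_ge0 (dual_valP _)) h2.
  have l1 : 0 < (2 * l)^-1 by rewrite invr_gt0; lra.
  have := ler_wpM2r (ltW l1) h1; have := ler_wpM2l (_ : 0 <= l / 2) h2.
  move=> /(_ ltac:(lra)); lra.
- move=> e r Er; rewrite leNgt; apply/negP => neg; apply: noz.
  exists (e.1 + p), (fun x => e.2 x + ps x), (r + (e.2 p + ps p) + ps (e.1 + p) - ps p + eta).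
  split => //; first exact: dual_elem_add (dual_valP _) dps.
  rewrite addrK; under [in dnorm _]eq_fun do rewrite addrK.
  move: neg; rewrite /q; lra.
move=> L [Llin Lle].
pose us x := L (x, 0); pose uss (h : @dual_space R X) := L (0, h).
have LE x (h : @dual_space R X) : L (x, h) = us x + uss h.
  have := Llin 1 (x, 0) (0, h); rewrite scale1r mul1r => <-.
  by congr L; congr pair; rewrite ?addr0 ?add0r.
have l1 : 0 < (2 * l)^-1 by rewrite invr_gt0; lra.
have us_lin : linear_form us.
  move=> a x y; rewrite /us -Llin; congr L; congr pair => /=.
  by rewrite scaler0 addr0.
have uss_lin : linear_form uss.
  move=> a x y; rewrite /uss -Llin; congr L; congr pair => /=.
  by rewrite scaler0 addr0.
have dus : dual_elem us.
  (* The single epigraph point [(e0, r0)] bounds [L] on the unit ball. *)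
  split => //; exists (r0 + ((`|e0.1| + 1) ^+ 2 / (2 * l) + l / 2 * dnorm e0.2 ^+ 2)).
  apply: linear_form_bounded => // [a z|z z1]; first by rewrite normrZ.
  apply: le_trans (Lle _ _ _ E0) _; rewrite lerD2l /q /= addr0 lerD2r ler_wpM2r ?(ltW l1)//.
  apply: lerXn2r; rewrite ?nnegrE ?addr_ge0//.
  by rewrite (le_trans (ler_normD _ _))// lerD2l.
have [C uC] : exists C, forall h : @dual_space R X, `|uss h| <= C * dnorm h.
  exists (r0 + (`|e0.1| ^+ 2 / (2 * l) + l / 2 * (dnorm e0.2 + 1) ^+ 2)).
  apply: linear_form_bounded => // [z|a z|z z1]; first exact: dnorm_ge0 (dual_valP _).
    exact: dnormZ (dual_valP _).
  apply: le_trans (Lle _ _ _ E0) _; rewrite lerD2l /q.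
  have -> : (e0 + (0, z)).2 = e0.2 + z by [].
  have -> : (e0 + (0, z)).1 = e0.1 by exact: addr0.
  rewrite lerD2l ler_wpM2l ?divr_ge0 ?(ltW l0)//.
  have n0 := dnorm_ge0 (dual_valP e0.2).
  apply: lerXn2r; rewrite ?nnegrE; [exact: dnorm_ge0 (dual_valP _)|lra|].
  apply: le_trans (dnormD (dual_valP _) (dual_valP _)) _.
  by rewrite lerD2l.
(* The pair [(F, ps - us)] is [(p, ps)], seen in the bidual and the dual, minus the two components
   of [L]. *)
pose F (h : X -> R) := h p - uss (to_dual h).
have dF : bidual_elem F.
  split.
    move=> a f g df dg; rewrite /F.
    have -> : to_dual (fun x => a * f x + g x) = a *: to_dual f + 1 *: to_dual g.
      apply: dual_space_eq => x; rewrite dual_valE !to_dualE ?mul1r//.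
      exact: dual_elem_lin.
    by rewrite uss_lin linear_formZ//; ring.
  exists (`|p| + C) => f df; rewrite /F (le_trans (ler_normB _ _))// mulrDl.
  rewrite lerD//; first by rewrite mulrC le_dnorm.
  by have := uC (to_dual f); rewrite to_dualE.
have dpu : dual_elem (fun x => ps x - us x) by exact: dual_elem_sub.
have [y [g [Ayg]]] := type_D_neg_infimum hD Adual dF dpu (ltac:(lra) : 0 < eta / 2).
have dg := Adual _ _ Ayg.
have dgs : dual_elem (fun x => g x - ps x) by exact: dual_elem_sub.
pose w : @dual_space R X := to_dual (fun x => g x - ps x).
pose us' := to_dual us.
have -> : F (fun z => ps z - us z - g z) = - (g p - ps p) - us p + uss w + uss us'.
  rewrite /F.
  have -> : to_dual (fun z => ps z - us z - g z) = -1 *: w + -1 *: us'.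
    apply: dual_space_eq => x; rewrite dual_valE !to_dualE//; last exact: dual_elem_sub.
    by ring.
  rewrite uss_lin linear_formZ//; lra.
have [x xus] := norming_conjugate dus l0 (ltac:(lra) : 0 < eta / 4).
(* The increment carries [(y - p, w)] to [(x, - us)], where [q] is at most [us x + eta / 4]. The
   bounds then add up to [3 * eta / 4 < eta / 2]. *)
have := Lle _ _ (x - (y - p), -1 *: us' + -1 *: w) (EA _ _ Ayg).
rewrite LE /q.
have -> : ((y - p, w) + (x - (y - p), -1 *: us' + -1 *: w)).1 = x.
  by rewrite /= addrC subrK.
have -> : ((y - p, w) + (x - (y - p), -1 *: us' + -1 *: w)).2 = -1 *: us' + 0 *: us'.
  apply: dual_space_eq => z; rewrite dual_valE.
  change (w z + (-1 *: us' + -1 *: w) z = -1 * us' z + 0 * us' z).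
  by rewrite dual_valE; ring.
have nle : dnorm (-1 *: us' + 0 *: us') ^+ 2 <= dnorm us ^+ 2.
  have usE : us = us' :> (X -> R) by rewrite /us' to_dualE.
  apply: lerXn2r; rewrite ?nnegrE ?dnorm_ge0//; first exact: dual_valP.
  apply: dnorm_le => [|z]; first exact: dnorm_ge0.
  rewrite dual_valE mul0r addr0 mulN1r normrN -usE; exact: le_dnorm.
have := ler_wpM2l (ltac:(lra) : 0 <= l / 2) nle.
rewrite uss_lin (linear_formZ _ w uss_lin).
rewrite !(dual_elemB _ _ dus) !(dual_elemB _ _ dg) !(dual_elemB _ _ dps).
move: xus; lra.
Qed.

End NegativeInfimum.

(** * The Fitzpatrick function compared with the duality product, and limits at a geometric rate *)

Section ExactPoints.
Context {R : realType} {X : normedModType R} {A : X -> set (X -> R)}.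
Hypothesis hA : maximal_monotone A.
Implicit Types (f g h : X -> R) (x y p : X).

(** A smaller [r] would make [(x, f)] monotonically related to the graph, hence a member of it by
    maximality; testing [fr] at that very point gives [f x <= r]. *)
Lemma fitz_ge x f r : dual_elem f -> fitz_le A x f r -> f x <= r.
Proof.
move=> df fr; rewrite leNgt; apply/negP => rf.
suff /fr : A x f by lra.
apply: hA.2 => // y g Ayg.
have := fr y g Ayg.
by rewrite !(dual_elemB _ _ df) !(dual_elemB _ _ (hA.1.1 _ _ Ayg)); lra.
Qed.

Lemma fitz_le_mem x f : dual_elem f -> fitz_le A x f (f x) -> A x f.
Proof.
move=> df fr; apply: hA.2 => // y g Ayg.
have := fr y g Ayg.
by rewrite !(dual_elemB _ _ df) !(dual_elemB _ _ (hA.1.1 _ _ Ayg)); lra.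
Qed.

Lemma mem_fitz_le x f : A x f -> fitz_le A x f (f x).
Proof.
move=> Axf y g Ayg; have := hA.1.2 _ _ _ _ Axf Ayg.
rewrite !(dual_elemB _ _ (hA.1.1 _ _ Axf)) !(dual_elemB _ _ (hA.1.1 _ _ Ayg)).
lra.
Qed.

Lemma fitz_leW x f r s : r <= s -> fitz_le A x f r -> fitz_le A x f s.
Proof. by move=> rs fr y g /fr; lra. Qed.

(* Compares the convex Fitzpatrick function with the duality product, which it
   dominates, at the midpoint of the two points. *)
Lemma fitz_almost_monotone x1 f1 e1 x2 f2 e2 :
  dual_elem f1 -> dual_elem f2 ->
  fitz_le A x1 f1 (f1 x1 + e1) -> fitz_le A x2 f2 (f2 x2 + e2) ->
  - (2 * (e1 + e2)) <= f1 (x1 - x2) - f2 (x1 - x2).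
Proof.
move=> d1 d2 h1 h2.
pose f (x : X) := 2^-1 * f1 x + (2^-1 * f2 x).
have df : dual_elem f.
  apply: dual_elem_lin => //; have := dual_elem_lin 2^-1 d2 dual_elem_cst0.
  by under eq_fun do rewrite addr0.
have hf : fitz_le A (2^-1 *: (x1 + x2)) f ((f1 x1 + e1 + (f2 x2 + e2)) / 2).
  move=> y g Ayg; have := h1 y g Ayg; have := h2 y g Ayg.
  have dg := hA.1.1 _ _ Ayg.
  by rewrite (dual_elemZ _ _ dg) (dual_elemD _ _ dg) /f; lra.
have := fitz_ge df hf.
rewrite (dual_elemZ _ _ df) (dual_elemD _ _ df) /f.
by rewrite !(dual_elemB _ _ d1) !(dual_elemB _ _ d2); lra.
Qed.

(** A completed square: the pairing and the penalties together are nonnegative, so they cannot hide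
    an excess of the Fitzpatrick function over the duality product. *)
Lemma young_pairing f x (l : R) : dual_elem f -> 0 < l ->
  0 <= f x + `|x| ^+ 2 / (2 * l) + l / 2 * dnorm f ^+ 2.
Proof.
move=> df l0; have := dual_elem_ge x df.
set n := dnorm f; set m := `|x| => h.
have : 0 <= (m - l * n) ^+ 2 / (2 * l) by rewrite divr_ge0 ?sqr_ge0//; lra.
have -> : (m - l * n) ^+ 2 / (2 * l) = m ^+ 2 / (2 * l) + l / 2 * n ^+ 2 - n * m.
  by field; rewrite gt_eqF.
lra.
Qed.

Lemma le0_geometric (a K : R) : (forall n, a <= K / 2 ^+ n) -> a <= 0.
Proof.
move=> aK; rewrite leNgt; apply/negP => a0.
have [n nK] : exists n : nat, K / a < n%:R.
  exists (Num.truncn (Num.max 0 (K / a))).+1.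
  apply: le_lt_trans (truncnS_gt _); by rewrite le_max lexx orbT.
have n2 : (n%:R : R) <= 2 ^+ n by rewrite -natrX ler_nat ltnW// ltn_expl.
have := aK n; rewrite ler_pdivlMr ?exprn_gt0// mulrC.
move: nK; rewrite ltr_pdivrMr// => nK.
by have := ler_wpM2r (ltW a0) n2; lra.
Qed.

End ExactPoints.

Lemma geometric_cauchy_limit {R : realType} {V : completeNormedModType R}
  (u : nat -> V) (rho : R) : (forall n, `|u n.+1 - u n| <= rho / 2 ^+ n.+1) ->
  exists l, forall n, `|l - u n| <= rho / 2 ^+ n.
Proof.
move=> hu.
have p2 n : 0 < (2 : R) ^+ n by rewrite exprn_gt0.
have rho0 : 0 <= rho.
  by have := le_trans (normr_ge0 _) (hu 0%N); rewrite expr1; lra.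
(* Subtracting the tail [rho / 2 ^+ (n + k)] gives the exact geometric sum, which lets the induction
   close. *)
have huk n k : `|u (n + k)%N - u n| <= rho / 2 ^+ n - rho / 2 ^+ (n + k).
  elim: k => [|k IH]; first by rewrite addn0 !subrr normr0.
  rewrite addnS; have := ler_distD (u (n + k)%N) (u (n + k).+1) (u n).
  have := hu (n + k)%N.
  have -> : rho / 2 ^+ (n + k).+1 = rho / 2 ^+ (n + k) / 2.
    by rewrite exprSr invfM mulrA.
  lra.
have huk' n m : (n <= m)%N -> `|u m - u n| <= rho / 2 ^+ n.
  move=> nm; have := huk n (m - n)%N; rewrite subnKC//.
  have : 0 <= rho / 2 ^+ m by rewrite divr_ge0// ltW.
  lra.
have ucvg : cvgn u.
  apply/cauchy_cvgP/cauchyP => e e0.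
  have [n hn] : exists n, rho / 2 ^+ n < e.
    apply: contrapT => no; suff : e <= 0 by lra.
    apply: (@le0_geometric _ _ rho) => n; rewrite leNgt; apply/negP => h.
    by apply: no; exists n.
  exists (u n); exists n => // m /= nm.
  by rewrite -ball_normE /= distrC (le_lt_trans (huk' _ _ nm)).
exists (limn u) => n.
have cv : (fun m => `|u m - u n|) @ \oo --> `|limn u - u n|.
  by apply: cvg_norm; apply: cvgB => //; exact: cvg_cst.
rewrite -(cvg_lim _ cv)//; apply: limr_le; first by apply/cvg_ex; exists (`|limn u - u n|).
by exists n => // m /=; exact: huk'.
Qed.

(** * Brondsted-Rockafellar property and approximate resolvents *)

Lemma le_of_sqr {R : realDomainType} (a b : R) :
  0 <= b -> a ^+ 2 <= b ^+ 2 -> a <= b.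
Proof.
move=> b0 ab; rewrite leNgt; apply/negP => ba; move: ab.
by rewrite ler_sqr ?nnegrE ?(le_trans b0 (ltW ba))// leNgt ba.
Qed.

Section Resolvent.
Context {R : realType} {X : completeNormedModType R} {A : X -> set (X -> R)}.
Hypotheses (hA : maximal_monotone A) (hD : type_D A).
Hypothesis A_neq0 : exists x f, A x f.
Implicit Types (f g h : X -> R) (x y p : X).

(** The error allowed at stage [n] is a tenth of the squared length of the next step; at [n = 0] it
    is [rho ^+ 2 / 40]. *)
Let eta_ (rho : R) n := (rho / 2 ^+ n.+1) ^+ 2 / 10.

(** Regularizing at [(x, f)] itself with [l = 1] leaves an excess of at most [s ^+ 2 / 40], by
    Young's inequality. Almost monotonicity bounds the pairing of the two increments from below, so
    the penalties control both displacements. *)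
Let fitz_improve (rho : R) n x f : 0 < rho -> dual_elem f ->
  fitz_le A x f (f x + eta_ rho n) ->
  exists y g, [/\ dual_elem g, fitz_le A y g (g y + eta_ rho n.+1),
    `|y - x| <= rho / 2 ^+ n.+1 & dnorm (fun z => g z - f z) <= rho / 2 ^+ n.+1].
Proof.
move=> rho0 df fx.
pose s : R := rho / 2 ^+ n.+1.
have s0 : 0 < s by rewrite divr_gt0// exprn_gt0.
have eS : eta_ rho n.+1 = s ^+ 2 / 40.
  by rewrite /eta_ (exprSr 2 n.+1) /s invfM mulrA; field; rewrite expf_neq0.
have eE : eta_ rho n = s ^+ 2 / 10 by [].
have s2 : 0 < s ^+ 2 by rewrite exprn_gt0.
have [y [g [r [dg gr hr]]]] :=
  regularized_point x hA hD A_neq0 df ltr01 (ltac:(lra) : 0 < s ^+ 2 / 40).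
have dgf : dual_elem (fun z => g z - f z) := dual_elem_sub dg df.
have gyr := fitz_ge hA dg gr.
have gr' : fitz_le A y g (g y + (r - g y)) by apply: fitz_leW gr; lra.
have := fitz_almost_monotone hA dg df gr' fx.
have := young_pairing (y - x) dgf ltr01.
rewrite !(dual_elemB _ _ dg) !(dual_elemB _ _ df) eE => h1 h2.
set a := `|y - x| in h1 hr *; set b := dnorm _ in h1 hr *.
have a0 : 0 <= a by exact: normr_ge0.
have b0 : 0 <= b by apply: dnorm_ge0.
have a2 : 0 <= a ^+ 2 by apply: sqr_ge0.
have b2 : 0 <= b ^+ 2 by apply: sqr_ge0.
have rgy : r <= g y + s ^+ 2 / 40 by clear -h1 hr; lra.
have ab : a ^+ 2 + b ^+ 2 <= s ^+ 2 by clear -h1 hr h2 rgy s2; lra.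
exists y, g; split => //.
- by rewrite eS; exact: fitz_leW gr.
- by apply: (@le_of_sqr _ a s); [exact: ltW|clear -ab b2; lra].
- by apply: (@le_of_sqr _ b s); [exact: ltW|clear -ab a2; lra].
Qed.

(* Brondsted-Rockafellar property: iterating [fitz_improve] with geometrically
   decreasing errors gives a Cauchy sequence whose limit lies on the graph. *)
Lemma fitz_exact_point x f (rho : R) : 0 < rho -> dual_elem f ->
  fitz_le A x f (f x + rho ^+ 2 / 40) ->
  exists y g, [/\ A y g, `|y - x| <= rho & dnorm (fun z => g z - f z) <= rho].
Proof.
move=> rho0 df fx.
pose P n (u : X * (X -> R)) := dual_elem u.2 /\ fitz_le A u.1 u.2 (u.2 u.1 + eta_ rho n).
(* Stated as an implication, so that [choice] returns a total [next]; the invariant [P] is restored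
   by induction. *)
have step (nu : nat * (X * (X -> R))) : exists w, P nu.1 nu.2 ->
    [/\ P nu.1.+1 w, `|w.1 - nu.2.1| <= rho / 2 ^+ nu.1.+1
      & dnorm (fun z => w.2 z - nu.2.2 z) <= rho / 2 ^+ nu.1.+1].
  case: nu => n u /=; have [[du hu]|nP] := pselect (P n u); last by exists u.
  by have [y [g [? ? ? ?]]] := fitz_improve rho0 du hu; exists (y, g).
have [next nextP] := choice step.
pose U := fix U n := if n is m.+1 then next (m, U m) else (x, f).
have UP n : P n (U n).
  elim: n => [|n IH]; last by have [] := nextP (n, U n) IH.
  by split => //=; apply: fitz_leW fx; rewrite /eta_ expr1; lra.
have U1 n : `|(U n.+1).1 - (U n).1| <= rho / 2 ^+ n.+1.
  by have [] := nextP (n, U n) (UP n).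
have U2 n z : `|(U n.+1).2 z - (U n).2 z| <= rho * `|z| / 2 ^+ n.+1.
  have [[d1 _] _ h] := nextP (n, U n) (UP n).
  apply: le_trans (le_dnorm z (dual_elem_sub d1 (UP n).1)) _.
  by rewrite [leRHS]mulrAC ler_wpM2r.
have [y hy] := @geometric_cauchy_limit R X (fun n => (U n).1) rho U1.
(* The limit functional is built pointwise in [R]; its linearity and boundedness follow from the
   rate. *)
have limz z : exists l : R, forall n, `|l - (U n).2 z| <= rho * `|z| / 2 ^+ n.
  exact: (@geometric_cauchy_limit R R^o (fun n => (U n).2 z) (rho * `|z|) (fun n => U2 n z)).
have [g hg] := choice limz.
have g0 z : `|g z - f z| <= rho * `|z|.
  by have := hg z 0%N; rewrite expr0 divr1.
have glin a z1 z2 : g (a *: z1 + z2) = a * g z1 + g z2.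
  pose K := rho * `|a *: z1 + z2| + `|a| * (rho * `|z1|) + rho * `|z2|.
  suff: `|g (a *: z1 + z2) - (a * g z1 + g z2)| <= 0.
    by rewrite normr_le0 subr_eq0 => /eqP.
  apply: (@le0_geometric _ _ K) => n.
  have dU := (UP n).1.
  have -> : g (a *: z1 + z2) - (a * g z1 + g z2) =
     (g (a *: z1 + z2) - (U n).2 (a *: z1 + z2)) +
     (- a * (g z1 - (U n).2 z1) - (g z2 - (U n).2 z2)).
    by rewrite dU.1; ring.
  apply: le_trans (ler_normD _ _) _.
  rewrite /K mulrDl mulrDl -addrA lerD ?hg//.
  apply: le_trans (ler_normB _ _) _.
  by rewrite lerD ?hg// normrM normrN -mulrA ler_wpM2l ?hg.
have dg : dual_elem g.
  split => //; exists (rho + dnorm f) => z.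
  have -> : g z = (g z - f z) + f z by ring.
  by rewrite (le_trans (ler_normD _ _))// mulrDl lerD// le_dnorm.
exists y, g; split.
- apply: (fitz_le_mem hA dg) => z h Azh.
  have dh := hA.1.1 _ _ Azh.
  rewrite -subr_le0.
  (* Each term is the coefficient of [2 ^- n] in one of the errors [e1] to [e5] made when [U n] is
     replaced by [(y, g)]. *)
  pose K := dnorm h * rho + rho * `|z| + rho ^+ 2 + (dnorm g + rho) * rho + rho * `|y|.
  apply: (@le0_geometric _ _ K) => n.
  have p2 : 0 < (2 : R) ^+ n by rewrite exprn_gt0.
  pose s := (2 ^+ n : R)^-1.
  have s0 : 0 < s by rewrite invr_gt0.
  have s1 : s <= 1 by rewrite invf_le1// exprn_ege1// ler1n.
  have [dU /(_ z h Azh) hU] := UP n.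
  have e1 : eta_ rho n <= rho ^+ 2 * s.
    rewrite /eta_ (exprSr 2 n) invfM mulrA -/s.
    have := sqr_ge0 rho; have : s ^+ 2 <= s by rewrite expr2 ler_piMr// ltW.
    have -> : (rho * s / 2) ^+ 2 / 10 = (rho ^+ 2) * (s ^+ 2) / 40 by field.
    by move=> sl r0; have := ler_wpM2l r0 sl; have := mulr_ge0 r0 (ltW s0); lra.
  have e2 : h y - h (U n).1 <= dnorm h * (rho * s).
    rewrite -(dual_elemB _ _ dh) (le_trans (dual_elem_le _ dh))//.
    by rewrite ler_wpM2l ?dnorm_ge0// hy.
  have e3 : g z - (U n).2 z <= rho * `|z| * s by rewrite (le_trans (ler_norm _))// hg.
  have e4 : (U n).2 y - g y <= rho * `|y| * s.
    by rewrite (le_trans (ler_norm _))// distrC hg.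
  have e5 : (U n).2 (U n).1 - (U n).2 y <= (dnorm g + rho) * (rho * s).
    rewrite -(dual_elemB _ _ dU).
    have -> : (U n).2 ((U n).1 - y) =
        g ((U n).1 - y) - (g ((U n).1 - y) - (U n).2 ((U n).1 - y)) by ring.
    have ny : `|(U n).1 - y| <= rho * s by rewrite distrC hy.
    apply: (@le_trans _ _ ((dnorm g + rho) * `|(U n).1 - y|)); last first.
      by rewrite ler_wpM2l// addr_ge0 ?dnorm_ge0// ltW.
    rewrite mulrDl lerD ?dual_elem_le// (le_trans (ler_norm _))// normrN (le_trans (hg _ n))//.
    by rewrite ler_piMr// mulr_ge0// ltW.
  rewrite -/s /K; lra.
- by have := hy 0%N; rewrite expr0 divr1.
- by apply: dnorm_le => //; exact: ltW.
Qed.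

(** The regularized point for [ps = 0] is bounded independently of [rho], by almost monotonicity
    against one fixed graph point. Moving it onto the graph by at most [rho] then changes the
    expression by at most [rho * K]. *)
Lemma approximate_resolvent p (l eta : R) : 0 < l -> 0 < eta ->
  exists y a, A y a /\
    a (y - p) + `|y - p| ^+ 2 / (2 * l) + l / 2 * dnorm a ^+ 2 <= eta.
Proof.
move=> l0 eta0; have [y0 [a0 Aa0]] := A_neq0.
have da0 := hA.1.1 _ _ Aa0.
pose w := `|p - y0|; pose al := dnorm a0.
have w0 : 0 <= w by exact: normr_ge0.
have al0 : 0 <= al by exact: dnorm_ge0.
pose B := 3 + al * w + w ^+ 2 / l + l * al ^+ 2.
have B0 : 0 <= B by rewrite !addr_ge0 ?mulr_ge0 ?sqr_ge0 ?invr_ge0 ?(ltW l0).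
(* The first two terms bound the squares of the two norms; [+ 1] passes to the norms through
   [2 * D <= D ^+ 2 + 1]. *)
pose M := 4 * l * B + 4 * B / l + 1.
have lB : 0 <= l * B by rewrite mulr_ge0// ltW.
have Bl : 0 <= B / l by rewrite divr_ge0// ltW.
have M0 : 0 <= M by rewrite /M; lra.
pose K := (2 * M + 1) / (2 * l) + l / 2 * (2 * M + 1) + (2 * M + 1).
have K0 : 0 <= K.
  by rewrite !addr_ge0 ?mulr_ge0 ?invr_ge0 ?mulr_ge0//; lra.
(* In [K + 1], the [1] pays for the value at the regularized point, which is at most
   [rho ^+ 2 / 40 <= rho]. *)
pose rho := Num.min 1 (eta / (K + 1)).
have rho0 : 0 < rho by rewrite lt_min ltr01 divr_gt0//; lra.
have rho1 : rho <= 1 by rewrite ge_min lexx.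
have rhoK : rho * (K + 1) <= eta.
  by rewrite -ler_pdivlMr; [rewrite ge_min lexx orbT|lra].
have rho2 : rho ^+ 2 <= rho by rewrite expr2 ler_piMr// ltW.
have rho20 : 0 < rho ^+ 2 by rewrite exprn_gt0.
have [x [f [r [df fr]]]] := regularized_point p hA hD A_neq0 dual_elem_cst0 l0
   (ltac:(lra) : 0 < rho ^+ 2 / 40).
under eq_fun do rewrite subr0.
move=> hr.
have := young_pairing (x - p) df l0; rewrite (dual_elemB _ _ df) => yp.
have frx : fitz_le A x f (f x + rho ^+ 2 / 40) by apply: fitz_leW fr; lra.
have fxr := fitz_ge hA df fr.
have Aa0' : fitz_le A y0 a0 (a0 y0 + 0) by rewrite addr0; exact: mem_fitz_le.
have am := fitz_almost_monotone hA df da0 frx Aa0'.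
set D := `|x - p| in hr yp; set N := dnorm f in hr yp.
have D0 : 0 <= D by exact: normr_ge0.
have N0 : 0 <= N by exact: dnorm_ge0.
have xy : x - y0 = (x - p) + (p - y0) by rewrite addrA subrK.
have h1 : f (p - y0) <= N * w by exact: dual_elem_le.
have h2 : - a0 (x - p) <= al * D by have := dual_elem_ge (x - p) da0; rewrite -/D -/al; lra.
have h3 : - a0 (p - y0) <= al * w by have := dual_elem_ge (p - y0) da0; rewrite -/w -/al; lra.
rewrite xy (dual_elemD _ _ df) (dual_elemD _ _ da0) (dual_elemB x p df) in am.
have y1 : N * w <= l / 4 * N ^+ 2 + w ^+ 2 / l.
  have : 0 <= (l * N / 2 - w) ^+ 2 / l by rewrite divr_ge0 ?sqr_ge0 ?(ltW l0).
  have -> : (l * N / 2 - w) ^+ 2 / l = l / 4 * N ^+ 2 + w ^+ 2 / l - N * w.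
    by field; rewrite gt_eqF.
  lra.
have y2 : al * D <= D ^+ 2 / (4 * l) + l * al ^+ 2.
  have : 0 <= (D / 2 - l * al) ^+ 2 / l by rewrite divr_ge0 ?sqr_ge0 ?(ltW l0).
  have -> : (D / 2 - l * al) ^+ 2 / l = D ^+ 2 / (4 * l) + l * al ^+ 2 - al * D.
    by field; rewrite gt_eqF.
  lra.
have Dl : D ^+ 2 / (2 * l) = 2 * (D ^+ 2 / (4 * l)) by field; rewrite gt_eqF.
have bnd : D ^+ 2 / (4 * l) + l / 4 * N ^+ 2 <= B.
  by rewrite Dl in hr; rewrite /B; clear -hr am fxr y1 y2 h1 h2 h3 rho1 rho2; lra.
have DM : D <= M.
  have : D ^+ 2 / (4 * l) <= B.
    have : 0 <= l / 4 * N ^+ 2 by rewrite mulr_ge0 ?sqr_ge0//; lra.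
    by clear -bnd; lra.
  rewrite ler_pdivrMr; last by lra.
  by have := sqr_ge0 (D - 1); rewrite /M; lra.
have NM : N <= M.
  have : N ^+ 2 <= 4 * B / l.
    rewrite ler_pdivlMr//; have : 0 <= D ^+ 2 / (4 * l) by rewrite divr_ge0 ?sqr_ge0//; lra.
    lra.
  by have := sqr_ge0 (N - 1); rewrite /M; lra.
have [y [a [Aya yx af]]] := fitz_exact_point rho0 df frx.
have da := hA.1.1 _ _ Aya.
exists y, a; split => //.
have daf := dual_elem_sub da df.
have ny : `|y - p| <= D + rho.
  have := ler_distD x y p; rewrite -/D; lra.
have na : dnorm a <= N + rho by have := dnorm_sub da df; rewrite -/N; lra.
have sqy : `|y - p| ^+ 2 <= D ^+ 2 + rho * (2 * M + 1).
  have : `|y - p| ^+ 2 <= (D + rho) ^+ 2 by rewrite lerXn2r ?nnegrE//; lra.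
  by have := ler_wpM2l (ltW rho0) DM; lra.
have sqa : dnorm a ^+ 2 <= N ^+ 2 + rho * (2 * M + 1).
  have : dnorm a ^+ 2 <= (N + rho) ^+ 2.
    by rewrite lerXn2r ?nnegrE ?dnorm_ge0//; lra.
  by have := ler_wpM2l (ltW rho0) NM; lra.
have pa : a (y - p) <= f (x - p) + rho * (2 * M + 1).
  have e1 : a (y - p) - f (y - p) <= rho * (M + 1).
    apply: le_trans (dual_elem_le (y - p) daf) _.
    by apply: ler_pM; rewrite ?dnorm_ge0//; lra.
  have e2 : f (y - x) <= M * rho.
    by apply: le_trans (dual_elem_le _ df) _; apply: ler_pM => //; exact: dnorm_ge0.
  have -> : a (y - p) = (a (y - p) - f (y - p)) + f (x - p) + f (y - x).
    by rewrite !(dual_elemB _ _ df); ring.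
  lra.
have i0 : 0 < (2 * l)^-1 by rewrite invr_gt0; lra.
have := ler_wpM2r (ltW i0) sqy; have := ler_wpM2l (ltac:(lra) : 0 <= l / 2) sqa.
rewrite (dual_elemB _ _ df) in pa.
have KE : rho * K =
    rho * (2 * M + 1) / (2 * l) + l / 2 * (rho * (2 * M + 1)) + rho * (2 * M + 1).
  by rewrite /K; ring.
by lra.
Qed.

End Resolvent.

(** * Bounded sequences in the graph *)

(** By compactness of a segment. A single ultrafilter thus gives limits at all vectors
    simultaneously. *)
Lemma ultra_bounded_lim {R : realType} {I : Type} (U : set_system I)
  (b : I -> R) (C : R) :
  UltraFilter U -> (forall i, `|b i| <= C) ->
  exists l, forall e : R, 0 < e -> U [set i | `|b i - l| < e].
Proof.
move=> UU bC.
have [|l [_ lcl]] := @segment_compact R (- C) C (b @ U) _.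
  by apply: (@filterE I U) => i; rewrite /= in_itv /= -ler_norml; exact: bC.
exists (l : R) => e e0.
have [//|Un] := in_ultra_setVsetC [set i | `|b i - l| < e] UU.
have [z [[i zi zb] ez]] := lcl (b @` [set i | ~ `|b i - l| < e]) (ball l e)
  (filterS (fun i ni => ex_intro2 _ _ i ni erefl) Un) (nbhsx_ballx l e e0).
by exfalso; apply: zi; rewrite zb distrC; move: ez; rewrite -ball_normE.
Qed.

Section BoundedSequences.
Context {R : realType} {X : normedModType R} {A : X -> set (X -> R)}.
Hypothesis hA : maximal_monotone A.
Implicit Types (f g h : X -> R) (x y p : X).

(* Banach-Alaoglu along an ultrafilter, combined with the closedness of the
   graph of a maximal monotone operator. *)
Lemma bounded_graph_cluster (y : nat -> X) (a : nat -> X -> R) x (M : R) :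
  (forall n, A (y n) (a n)) -> (forall n, dnorm (a n) <= M) ->
  (forall e : R, 0 < e -> exists n0, forall n, (n0 <= n)%N -> `|y n - x| < e) ->
  exists f, A x f /\
    forall z c, (exists n0, forall n, (n0 <= n)%N -> c <= a n z) -> c <= f z.
Proof.
move=> Aya aM yx.
have [U [UU Uoo]] := ultraFilterLemma eventually_filter.
have da n : dual_elem (a n) := hA.1.1 _ _ (Aya n).
have M0 : 0 <= M := le_trans (dnorm_ge0 (da 0%N)) (aM 0%N).
have az n z : `|a n z| <= M * `|z|.
  by rewrite (le_trans (le_dnorm z (da n)))// ler_wpM2r.
(* The ultrafilter is fixed before [z], so the pointwise limits are compatible and [f] inherits
   linearity. *)
have [f fU] := choice (fun z => ultra_bounded_lim UU (az^~ z)).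
have Uev n0 : U [set n | (n0 <= n)%N] by apply: Uoo; exists n0.
have fM z : `|f z| <= M * `|z|.
  apply/ler_addgt0Pr => e e0; have [n hn] := filter_ex (fU z e e0).
  have := ler_distD (a n z) (f z) 0; rewrite !subr0 distrC.
  by have := az n z; move: hn => /=; lra.
have flin (s : R) z w : f (s *: z + w) = s * f z + f w.
  apply/eqP; rewrite -subr_eq0 -normr_le0; apply/ler_addgt0Pr => e e0.
  pose d := e / (`|s| + 2).
  have s0 : 0 <= `|s| by [].
  have d0 : 0 < d by rewrite divr_gt0//; lra.
  have dE : d + `|s| * d + d = e by rewrite /d; field; rewrite gt_eqF//; lra.
  have [n [[h1 h2] h3]] :=
    filter_ex (filterI (filterI (fU (s *: z + w) d d0) (fU z d d0)) (fU w d d0)).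
  rewrite add0r -dE.
  have -> : f (s *: z + w) - (s * f z + f w) =
     - (a n (s *: z + w) - f (s *: z + w)) + s * (a n z - f z) + (a n w - f w).
    by rewrite (da n).1; ring.
  apply: le_trans (ler_normD _ _) _; apply: lerD; last exact: ltW.
  apply: le_trans (ler_normD _ _) _; apply: lerD; first by rewrite normrN ltW.
  by rewrite normrM ler_wpM2l// ltW.
have df : dual_elem f by split => //; exists M.
have fge z c : (exists n0, forall n, (n0 <= n)%N -> c <= a n z) -> c <= f z.
  move=> [n0 hc]; apply/ler_addgt0Pr => e e0.
  have [n [h1 /hc h2]] := filter_ex (filterI (fU z e e0) (Uev n0)).
  by move: h1; rewrite /= ltr_norml; lra.
exists f; split => //; apply: hA.2 => // z g Azg.
have dg := hA.1.1 _ _ Azg.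
have dg0 := dnorm_ge0 dg.
apply/ler_addgt0Pr => e e0.
pose d := e / (1 + M + dnorm g).
have d0 : 0 < d by rewrite divr_gt0//; lra.
have dE : d + M * d + dnorm g * d = e by rewrite /d; field; rewrite gt_eqF//; lra.
have [n0 hn0] := yx d d0.
have [n [h1 /hn0 h2]] := filter_ex (filterI (fU (x - z) d d0) (Uev n0)).
have := hA.1.2 _ _ _ _ (Aya n) Azg.
(* The first summand tends to [0] in norm against bounded functionals; on the second, [a n]
   converges along the ultrafilter. *)
have -> : y n - z = (y n - x) + (x - z) by rewrite addrA subrK.
rewrite (dual_elemD _ _ (da n)) (dual_elemD _ _ dg).
have h3 : a n (y n - x) <= M * d.
  by rewrite (le_trans (ler_norm _))// (le_trans (az _ _))// ler_wpM2l// ltW.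
have h4 : - (dnorm g * d) <= g (y n - x).
  have := dual_elem_ge (y n - x) dg.
  by have := ler_wpM2l dg0 (ltW h2); lra.
by move: h1; rewrite /= ltr_norml -dE; lra.
Qed.

(** Norm to weak-star upper semicontinuity on bounded parts of the graph: a violating sequence would
    have a cluster point in [A x] with value at least [s + e] at [v]. *)
Lemma locally_bounded_usc x v (M s e : R) :
  (forall a, A x a -> a v <= s) -> 0 < e ->
  exists2 d : R, 0 < d & forall y a, A y a -> `|y - x| < d -> dnorm a <= M -> a v <= s + e.
Proof.
move=> hs e0; apply: contrapT => nd.
have bad (n : nat) : exists ya : X * (X -> R), [/\ A ya.1 ya.2,
    `|ya.1 - x| < n.+1%:R^-1, dnorm ya.2 <= M & s + e <= ya.2 v].
  apply: contrapT => no; apply: nd; exists n.+1%:R^-1; first by rewrite invr_gt0 ltr0n.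
  move=> y a Aya yx aM; rewrite leNgt; apply/negP => h.
  by apply: no; exists (y, a); split => //; exact: ltW.
have [ya yaP] := choice bad.
have [|||f [Axf fge]] := @bounded_graph_cluster (fun n => (ya n).1) (fun n => (ya n).2) x M.
- by move=> n; have [] := yaP n.
- by move=> n; have [] := yaP n.
- move=> d d0; exists (Num.truncn d^-1) => n hn.
  have [_ h _ _] := yaP n; apply: lt_le_trans h _.
  rewrite -[leRHS]invrK lef_pV2 ?posrE ?invr_gt0 ?ltr0n//.
  by rewrite ltW// (lt_le_trans (truncnS_gt _))// ler_nat ltnS.
- have := fge v (s + e); have := hs f Axf => h1 h2.
  have : s + e <= f v by apply: h2; exists 0%N => n _; have [] := yaP n.
  lra.
Qed.

(** A minimizing sequence has a weak-star cluster point in [A y], and the dual norm is weak-star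
    lower semicontinuous. *)
Lemma min_norm_exists y : dom_op A y -> exists a, is_min_norm A y a.
Proof.
move=> [a0 Aa0].
pose S := [set dnorm a | a in A y].
have Sinf : has_inf S.
  split; first by exists (dnorm a0), a0.
  by exists 0 => _ [a Aa <-]; apply: dnorm_ge0; exact: hA.1.1 Aa.
have near_inf (n : nat) : exists a, A y a /\ dnorm a <= inf S + n.+1%:R^-1.
  have [_ [a Aa <-] h] :=
    inf_adherent (ltac:(by rewrite invr_gt0 ltr0n) : 0 < n.+1%:R^-1) Sinf.
  by exists a; split => //; exact: ltW.
have [a aP] := choice near_inf.
have [|||f [Ayf fge]] := @bounded_graph_cluster (fun=> y) a y (inf S + 1).
- by move=> n; have [] := aP n.
- move=> n; apply: le_trans (aP n).2 _; rewrite lerD2l invf_le1 ?ler1n ?ltr0n//.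
- by move=> e e0; exists 0%N => n _; rewrite subrr normr0.
have inf0 : 0 <= inf S.
  by apply: lb_le_inf; [exact: Sinf.1|move=> _ [b Ab <-]; apply: dnorm_ge0; exact: hA.1.1 Ab].
have df := hA.1.1 _ _ Ayf.
(* [fge] transmits lower bounds only; using [z] and [- z] turns them into a norm bound. *)
have fN z : - (inf S * `|z|) <= f z.
  apply/ler_addgt0Pr => e e0; rewrite -lerBlDr; apply: fge.
  exists (Num.truncn (`|z| / e)) => n hn.
  have := dual_elem_ge z (hA.1.1 _ _ (aP n).1).
  have : n.+1%:R^-1 * `|z| <= e.
    rewrite ler_pdivrMl ?ltr0n// -ler_pdivrMr//.
    by rewrite ltW// (lt_le_trans (truncnS_gt _))// ler_nat ltnS.
  have := ler_wpM2r (normr_ge0 z) (aP n).2.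
  move: (n.+1%:R^-1) => k; lra.
exists f; split => // b Ab; apply: (@le_trans _ _ (inf S)).
  apply: dnorm_le => // z; rewrite ler_norml fN andTb.
  by have := fN (- z); rewrite normrN (dual_elemN _ df); lra.
by apply: ge_inf; [exact: Sinf.2|exists b].
Qed.

Lemma AminP y : dom_op A y -> is_min_norm A y (Amin A y).
Proof. by move=> Ay; apply: ClassicalEpsilon.epsilon_spec; exact: min_norm_exists. Qed.

End BoundedSequences.

(** * Recovery directions and the two inequalities *)

Section DirVal.
Context {R : realType} {X : normedModType R} (A : X -> set (X -> R)).

Lemma dir_val_dom (x : X) t w : dom_op A (x + t *: w) ->
  dir_val A x t w = (Amin A (x + t *: w) w)%:E.
Proof. by move=> h; rewrite /dir_val; destruct (pselect _). Qed.

Lemma dir_val_out (x : X) t w : ~ dom_op A (x + t *: w) -> dir_val A x t w = +oo%E.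
Proof. by move=> h; rewrite /dir_val; destruct (pselect _). Qed.

End DirVal.

(** The approximate resolvent at [x + t *: v] with parameter [ep * t] and error [c * t] becomes,
    after division by [t], an estimate for [w - v] and [a] free of [t]. *)
Lemma recovery_direction {R : realType} {X : completeNormedModType R}
  {A : X -> set (X -> R)} (x v : X) (s d e : R) :
  maximal_monotone A -> type_D A ->
  (forall a, A x a -> a v <= s) ->
  (forall r : R, 0 < r -> exists2 a, A x a & s - r < a v) -> 0 < d -> 0 < e ->
  exists (t : R) w, [/\ 0 < t, t < d, `|w - v| < d, dom_op A (x + t *: w) &
    Amin A (x + t *: w) w <= s + e].
Proof.
move=> hA hD ubs supA d0 e0.
(* The final error is [c + 8 * c], whence [9]; the bound [16 * c] on the square of [|w - v|] must
   stay below [d ^+ 2], whence [17]. *)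
pose c : R := Num.min (e / 9) (d ^+ 2 / 17).
have d20 : 0 < d ^+ 2 by rewrite exprn_gt0.
have c0 : 0 < c by rewrite lt_min; apply/andP; split; lra.
have ce : c <= e / 9 by rewrite ge_min lexx.
have cd : c <= d ^+ 2 / 17 by rewrite ge_min lexx orbT.
have [a0 Aa0 a0v] := supA c c0.
have da0 := hA.1.1 _ _ Aa0.
set al := dnorm a0; have al0 : 0 <= al by exact: dnorm_ge0.
have al20 : 0 <= al ^+ 2 by rewrite sqr_ge0.
pose ep : R := Num.min 1 (c / (al ^+ 2 + 1)).
have ep0 : 0 < ep by rewrite lt_min ltr01 divr_gt0//; clear -al20; lra.
have ep1 : ep <= 1 by rewrite ge_min lexx.
have epal : ep * al ^+ 2 <= c.
  have : ep * (al ^+ 2 + 1) <= c.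
    by rewrite -ler_pdivlMr; [rewrite ge_min lexx orbT|clear -al20; lra].
  by clear -ep0; lra.
clearbody ep c.
set nv := `|v|; have nv0 : 0 <= nv by exact: normr_ge0.
(* This coarse bound is independent of [t]. It fixes the norm bound for [a], hence the radius [d'],
   before [t] is chosen. *)
pose B := c + al * nv + nv ^+ 2 / ep + ep * al ^+ 2.
have B0 : 0 <= B by rewrite !addr_ge0 ?mulr_ge0 ?sqr_ge0 ?invr_ge0 ?(ltW ep0) ?(ltW c0).
have [d' d'0 usc] := locally_bounded_usc hA (4 * B / ep + 1) ubs c0.
have K0 : 0 < 2 * (nv + (4 * B + 1)) by clear -nv0 B0; lra.
pose t : R := Num.min (d / 2) (d' / (2 * (nv + (4 * B + 1)))).
have t0 : 0 < t by rewrite lt_min !divr_gt0.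
have td : t < d.
  have : t <= d / 2 by rewrite ge_min lexx.
  by clear -d0; lra.
have td' : t * (nv + (4 * B + 1)) < d'.
  have : t * (2 * (nv + (4 * B + 1))) <= d' by rewrite -ler_pdivlMr// ge_min lexx orbT.
  by clear -d'0; lra.
clearbody t.
have [y [a [Aya hya]]] := approximate_resolvent hA hD (ex_intro _ x (ex_intro _ a0 Aa0))
  (x + t *: v) (mulr_gt0 ep0 t0) (mulr_gt0 c0 t0).
have da := hA.1.1 _ _ Aya.
pose w := t^-1 *: (y - x).
have yE : y = x + t *: w by rewrite /w scalerA divff ?gt_eqF// scale1r addrC subrK.
have yxE : y - x = t *: w by rewrite {1}yE addrC addKr.
have yp : y - (x + t *: v) = t *: (w - v).
  by rewrite yE scalerBr opprD addrACA subrr add0r.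
rewrite yp normrZ (gtr0_norm t0) (dual_elemZ _ _ da) in hya.
set D := `|w - v| in hya; have D0 : 0 <= D by exact: normr_ge0.
set N := dnorm a in hya; have N0 : 0 <= N by exact: dnorm_ge0.
have {}hya : a (w - v) + D ^+ 2 / (2 * ep) + ep / 2 * N ^+ 2 <= c.
  rewrite -(ler_pM2r t0); apply: le_trans hya; rewrite le_eqVlt; apply/orP; left; apply/eqP.
  by field; rewrite !gt_eqF.
have mon : a0 w <= a w.
  have := hA.1.2 _ _ _ _ Aya Aa0; rewrite yxE.
  by rewrite (dual_elemZ _ _ da) (dual_elemZ _ _ da0) -mulrBr pmulr_rge0// subr_ge0.
have a0D : - (al * D) <= a0 (w - v) by exact: dual_elem_ge.
have aB := dual_elemB w v da; have a0B := dual_elemB w v da0.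
have main : D ^+ 2 / (2 * ep) + ep / 2 * N ^+ 2 <= c + a v - a0 v + al * D.
  by clear -hya mon a0D aB a0B; lra.
have Dl : D ^+ 2 / (2 * ep) = 2 * (D ^+ 2 / (4 * ep)) by field; rewrite gt_eqF.
have y2 : al * D <= D ^+ 2 / (4 * ep) + ep * al ^+ 2.
  have : 0 <= (D / 2 - ep * al) ^+ 2 / ep by rewrite divr_ge0 ?sqr_ge0 ?(ltW ep0).
  have -> : (D / 2 - ep * al) ^+ 2 / ep =
      D ^+ 2 / (4 * ep) + ep * al ^+ 2 - al * D by field; rewrite gt_eqF.
  by clear; lra.
have q0 : 0 <= D ^+ 2 / (4 * ep) by rewrite divr_ge0 ?sqr_ge0//; clear -ep0; lra.
have r0 : 0 <= ep / 2 * N ^+ 2 by rewrite mulr_ge0 ?sqr_ge0 ?divr_ge0 ?(ltW ep0).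
have bnd : D ^+ 2 / (4 * ep) + ep / 4 * N ^+ 2 <= B.
  have y1 : N * nv <= ep / 4 * N ^+ 2 + nv ^+ 2 / ep.
    have : 0 <= (ep * N / 2 - nv) ^+ 2 / ep by rewrite divr_ge0 ?sqr_ge0 ?(ltW ep0).
    have -> : (ep * N / 2 - nv) ^+ 2 / ep =
        ep / 4 * N ^+ 2 + nv ^+ 2 / ep - N * nv by field; rewrite gt_eqF.
    by clear; lra.
  have h1 : a v <= N * nv by exact: dual_elem_le.
  have h2 : - (al * nv) <= a0 v by exact: dual_elem_ge.
  by rewrite Dl in main; rewrite /B; clear -main y1 y2 h1 h2; lra.
have DB : D <= 4 * B + 1.
  have : D ^+ 2 <= B * (4 * ep).
    rewrite -ler_pdivrMr; last by clear -ep0; lra.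
    by clear -bnd r0; lra.
  have := ler_wpM2l B0 ep1; have := sqr_ge0 (D - 1); clear -B0; lra.
have NB : N <= 4 * B / ep + 1.
  have : N ^+ 2 <= 4 * B / ep by rewrite ler_pdivlMr//; clear -bnd q0; lra.
  have : 0 <= B / ep by rewrite divr_ge0// ltW.
  by have := sqr_ge0 (N - 1); clear; lra.
have yx : `|y - x| < d'.
  rewrite yxE normrZ (gtr0_norm t0); apply: le_lt_trans td'.
  rewrite ler_wpM2l ?(ltW t0)//; have := ler_distD v w 0; rewrite !subr0 -/D -/nv.
  by clear -DB; lra.
have av : a v <= s + c := usc y a Aya yx NB.
(* Upper semicontinuity gives [a v - a0 v <= 2 * c]; half of the quadratic term absorbs [al * D],
   leaving [ep * al ^+ 2 <= c]. *)
have key : D ^+ 2 / (4 * ep) + ep / 2 * N ^+ 2 <= 4 * c.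
  by rewrite Dl in main; clear -main y2 av a0v epal; lra.
have Dd : D < d.
  have : D ^+ 2 <= 4 * c * (4 * ep).
    rewrite -ler_pdivrMr; last by clear -ep0; lra.
    by clear -key r0; lra.
  have := ler_wpM2l (ltW c0) ep1 => h1 h2.
  rewrite ltNge; apply/negP => dD.
  have : d ^+ 2 <= D ^+ 2 by rewrite lerXn2r ?nnegrE// ltW.
  by clear -h1 h2 cd d20; lra.
have ND : N * D <= 8 * c.
  have : 0 <= (D - ep * N) ^+ 2 / ep by rewrite divr_ge0 ?sqr_ge0 ?(ltW ep0).
  have -> : (D - ep * N) ^+ 2 / ep =
      4 * (D ^+ 2 / (4 * ep)) + ep * N ^+ 2 - 2 * (N * D) by field; rewrite gt_eqF.
  by clear -key r0; lra.
have domy : dom_op A y by exists a.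
have [Am Amle] := AminP hA domy.
have dm := hA.1.1 _ _ Am.
exists t, w; rewrite -yE; split => //.
(* The minimal norm is at most [N], so the bounds obtained for [a] carry over to [Amin A y]. *)
have mv := usc y _ Am yx (le_trans (Amle _ Aya) NB).
have mD : Amin A y (w - v) <= N * D.
  by rewrite (le_trans (dual_elem_le _ dm))// ler_wpM2r// Amle.
rewrite (dual_elemB _ _ dm) in mD.
by clear -mv mD ND ce; lra.
Qed.

Theorem theorem4p2 (R : realType) (X : completeNormedModType R)
  (hsc1 : dual_strictly_convex X) (hsc2 : bidual_strictly_convex X)
  (hkk1 : w_Kadec_Klee X) (hkk2 : wstar_Kadec_Klee X)
  (A : X -> set (X -> R)) (hA : maximal_monotone A) (hD : type_D A)
  (x v : X) (hx : dom_op A x) (hv : v != 0) :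
  support_fun A x v = liminf_dir A x v.
Proof.
apply/eqP; rewrite eq_le; apply/andP; split.
  apply: ge_ereal_sup => _ [f Axf <-].
  have df := hA.1.1 _ _ Axf.
  apply/lee_addgt0Pr => e e0; rewrite -leeBlDr// -EFinB.
  (* On this radius [f w >= f v - e], and monotonicity carries the bound over to [Amin]. *)
  pose d := e / (dnorm f + 1).
  have f0 := dnorm_ge0 df.
  have d0 : 0 < d by rewrite divr_gt0//; lra.
  have fd : dnorm f * d <= e.
    by rewrite /d mulrCA ler_piMr ?(ltW e0)// ler_pdivrMr; lra.
  apply: le_ereal_sup_tmp; exists (ereal_inf [set y | exists (t : R) (w : X),
      [/\ 0 < t, t < d, `|w - v| < d & y = dir_val A x t w]]); first by exists d.
  apply: le_ereal_inf_tmp => _ [t [w [t0 td wv ->]]].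
  have [domw|ndom] := pselect (dom_op A (x + t *: w)); last first.
    by rewrite dir_val_out//; exact: leey.
  rewrite dir_val_dom//.
  have [Am _] := AminP hA domw.
  have := hA.1.2 _ _ _ _ Am Axf; have -> : x + t *: w - x = t *: w by rewrite addrC addKr.
  rewrite (dual_elemZ _ _ (hA.1.1 _ _ Am)) (dual_elemZ _ _ df) -mulrBr.
  rewrite pmulr_rge0// lee_fin => mon.
  have := dual_elem_ge (w - v) df; rewrite (dual_elemB _ _ df).
  by have := ler_wpM2l f0 (ltW wv); lra.
have [a0 Aa0] := hx.
(* The value [+oo] leaves nothing to prove, and [a0] excludes [-oo]. *)
case sE : (support_fun A x v) => [s||]; last 2 first.
- exact: leey.
- have : ((a0 v)%:E <= support_fun A x v)%E by apply: ereal_sup_ubound; exists a0.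
  by rewrite sE.
have ubs a : A x a -> a v <= s.
  by move=> Axa; rewrite -lee_fin -sE; apply: ereal_sup_ubound; exists a.
have supA (r : R) : 0 < r -> exists2 a, A x a & s - r < a v.
  move=> r0; apply: contrapT => no.
  have : (support_fun A x v <= (s - r)%:E)%E.
    apply: ge_ereal_sup => _ [a Axa <-]; rewrite lee_fin leNgt; apply/negP => h.
    by apply: no; exists a.
  by rewrite sE lee_fin; lra.
apply: ge_ereal_sup => _ [d /= d0 <-].
apply/lee_addgt0Pr => e e0.
have [t [w [t0 td wv domw le]]] := recovery_direction hA hD ubs supA d0 e0.
apply: le_trans (_ : _ <= (Amin A (x + t *: w) w)%:E)%E _; last by rewrite -EFinD lee_fin.
apply: ereal_inf_lbound; exists t, w; split => //.
by rewrite dir_val_dom.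
Qed.
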